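(* Let $n$ be a positive integer and let $H$ be a subgroup of a finite group $G$. Then the following statements are true. (i) If $G=HZ_n(G)$, then $d^{(n)}(H)=d^{(n)}(H,G)=d^{(n)}(G)$. (ii) $d^{(n)}(H,G)=d^{(n)}(\varphi(H),G)$ for every $\varphi\in \mathrm{Aut}(G)$.
   Context: $Z_n(G)$ denotes the $n$-th term of the upper central series of $G$. Commutators are left-normed: $[x_1,x_2]=x_1^{-1}x_2^{-1}x_1x_2$ and $[x_1,\dots,x_{k+1}]=[[x_1,\dots,x_k],x_{k+1}]$. For a finite group $G$, the $n$-th nilpotency degree of $G$ is $$d^{(n)}(G)=\frac{|\{(x_1,\dots,x_{n+1})\in G^{n+1} : [x_1,\dots,x_{n+1}]=1\}|}{|G|^{n+1}},$$ and for a subgroup $H$ of $G$ the relative $n$-th nilpotency degree of $H$ in $G$ is $$d^{(n)}(H,G)=\frac{|\{(x_1,\dots,x_n,g)\in H^n\times G : [x_1,\dots,x_n,g]=1\}|}{|H|^n|G|}.$$ *)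

(* Defs.v *)
From mathcomp Require Import all_boot all_order all_fingroup all_algebra all_solvable.

Set Implicit Arguments.
Unset Strict Implicit.
Unset Printing Implicit Defensive.

(* MathComp's [~ x, y] = x^-1 * x ^ y is x^-1 * y^-1 * x * y.  The value 1 on
   the empty sequence is a junk value; on [:: x] the commutator is x. *)
Definition lncomm (gT : finGroupType) (s : seq gT) : gT :=
  if s is x :: s' then foldl (fun u v : gT => [~ u, v]%g) x s' else 1%g.

(* As usual in MathComp, the arguments are sets, to be instantiated by groups. *)
Definition nildeg (gT : finGroupType) (n : nat) (G : {set gT}) : rat :=
  (#|[set x : n.+1.-tuple gT | all [in G] x && (lncomm x == 1%g)]|%:R
     / (#|G| ^ n.+1)%:R)%R.

Definition rel_nildeg (gT : finGroupType) (n : nat) (H G : {set gT}) : rat :=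
  (#|[set xg : n.-tuple gT * gT |
       [&& all [in H] xg.1, xg.2 \in G & lncomm (rcons xg.1 xg.2) == 1%g]]|%:R
     / (#|H| ^ n * #|G|)%:R)%R.

(* Main.v *)
Require Import Defs.
From mathcomp Require Import all_boot all_order all_fingroup all_algebra all_solvable.

Set Implicit Arguments.
Unset Strict Implicit.
Unset Printing Implicit Defensive.

Import GroupScope.

(** The truth value of [x_1, ..., x_(n+1)] = 1 depends only on the cosets of
    the x_i modulo the n-th centre Z_n(G).  Indeed each commutation costs one
    level of the upper central series: if the commutator of the first k + 1
    entries is known modulo Z_(m+1), then the next one is known modulo Z_m.
    Changing the early part of the commutator by an element of Z_(m+1) is
    harmless because Z_(m+1) is central modulo Z_m; changing the new entry by
    an element of Z_(m+k+1) is harmless because the commutator so far lies in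
    the term L_(k+1) of the lower central series and
    [L_(k+1), Z_(m+k+1)] <= Z_m, a consequence of the three subgroups lemma.
    Starting from entries known modulo Z_n, after n commutations the value is
    known modulo Z_0 = 1 ([lncomm_coset_ucn]).

    For (i), all three degrees are densities, in a product of n + 1 subgroups
    K_i of G with G = K_i Z_n(G), of the set of tuples with trivial commutator.
    This set is invariant under right multiplication by Z_n(G)^(n+1), and an
    invariant set has the same density in a subgroup H' as in H' Z'
    ([card_mulg_periodic], applied in the product group).  So each density
    equals the one in G^(n+1).

    For (ii), applying the automorphism to every entry is a bijection between
    the two sets of tuples being counted ([rel_nildeg_Aut]). *)

(** * Iterated commutators modulo the upper central series *)

Section LowerAgainstUpper.

Variable gT : finGroupType.
Implicit Types G H K N : {group gT}.

(** The three subgroups lemma in the quotient by [N]. *)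
Lemma three_subgroup_mod N G H K :
    G \subset 'N(N) -> H \subset 'N(N) -> K \subset 'N(N) ->
    [~: G, H, K] \subset N -> [~: H, K, G] \subset N -> [~: K, G, H] \subset N.
Proof.
move=> nNG nNH nNK.
have trivQ (A B C : {group gT}) :
  A \subset 'N(N) -> B \subset 'N(N) -> C \subset 'N(N) ->
  ([~: A, B, C] \subset N) = ([~: A / N, B / N, C / N] :==: 1).
  move=> nA nB nC; have nAB: [~: A, B] \subset 'N(N) by rewrite comm_subG.
  by rewrite -!quotientR // -subG1 quotient_sub1 // comm_subG.
rewrite !trivQ // => /eqP sGHK /eqP sHKG.
exact/eqP/three_subgroup.
Qed.

(** This extends [ucn_comm] to deeper lower central terms.  Since 'L_k.+2 is
    [~: 'L_k.+1, G], the three subgroups lemma replaces [~: 'L_k.+2, Z] by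
    [~: Z, G, 'L_k.+1] and [~: Z, 'L_k.+1, G]; there Z = 'Z_(m + k.+2) drops one
    level by commuting with G and k.+1 levels by commuting with 'L_k.+1. *)
Lemma comm_lcn_ucn G k m :
  [~: 'L_k.+1(G), 'Z_(m + k.+1)(G)] \subset 'Z_m(G).
Proof.
elim: k m => [|k IHk] m; first by rewrite addn1 lcn1 commGC ucn_comm.
rewrite lcnSn; apply: three_subgroup_mod.
- exact: ucn_norm.
- exact: subset_trans (ucn_sub _ _) (ucn_norm _ _).
- exact: subset_trans (lcn_sub _ _) (ucn_norm _ _).
- rewrite [[~: G, _]]commGC addnS.
  apply: subset_trans (commSg _ (ucn_comm _ _)) _.
  by rewrite commGC IHk.
- rewrite -addSnnS [[~: 'Z_(_)(G), _]]commGC.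
  exact: subset_trans (commSg _ (IHk _)) (ucn_comm _ _).
Qed.

Lemma lncomm_rcons (s : seq gT) x :
  s != [::] -> lncomm (rcons s x) = [~ lncomm s, x].
Proof. by case: s => //= y s _; rewrite -cats1 foldl_cat. Qed.

Lemma lncomm_in_lcn G (s : seq gT) k :
  size s = k.+1 -> all [in G] s -> lncomm s \in 'L_k.+1(G).
Proof.
elim: k s => [|k IHk] s; first by case: s => [|x []] //= _ /andP[].
case/lastP: s => // s x; rewrite size_rcons all_rcons => -[sz_s] /andP[Gx Gs].
rewrite lncomm_rcons -?size_eq0 ?sz_s // lcnSn.
by rewrite mem_commg ?IHk.
Qed.

(** One commutation costs one level: with c' = c a and x' = x b, modulo 'Z_m(G)
    the element a is central, while b commutes with both c and [~ c, x], which
    lie in 'L_k.+1(G); so a and b drop out of [~ c a, x b]. *)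
Lemma comm_coset_ucn G k m c c' x x' :
    c \in 'L_k.+1(G) -> c' \in G -> x \in G -> x' \in G ->
    coset 'Z_m.+1(G) c = coset 'Z_m.+1(G) c' ->
    coset 'Z_(m + k.+1)(G) x = coset 'Z_(m + k.+1)(G) x' ->
  coset 'Z_m(G) [~ c, x] = coset 'Z_m(G) [~ c', x'].
Proof.
move=> Lc Gc' Gx Gx' eq_c eq_x.
have Gc: c \in G := subsetP (lcn_sub _ _) c Lc.
have diff j u v : u \in G -> v \in G ->
    coset 'Z_j(G) u = coset 'Z_j(G) v -> exists2 a, a \in 'Z_j(G) & v = u * a.
  move=> Gu Gv eq_uv; exists (u^-1 * v); last by rewrite mulKVg.
  have nZ y : y \in G -> y \in 'N('Z_j(G)) := subsetP (ucn_norm j G) y.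
  by rewrite coset_idr ?nZ ?groupM ?groupV // morphM ?morphV ?nZ ?groupV //=
             eq_uv mulVg.
have [a Za def_c'] := diff _ _ _ Gc Gc' eq_c.
have [b Zb def_x'] := diff _ _ _ Gx Gx' eq_x.
have Ga: a \in G := subsetP (ucn_sub _ _) a Za.
have Gb: b \in G := subsetP (ucn_sub _ _) b Zb.
have nZ y : y \in G -> y \in 'N('Z_m(G)) := subsetP (ucn_norm m G) y.
have cent u v : u \in G -> v \in G -> [~ u, v] \in 'Z_m(G) ->
    commute (coset 'Z_m(G) u) (coset 'Z_m(G) v).
  by move=> Gu Gv Zuv; apply/commgP; rewrite -morphR ?nZ //= coset_id.
have centa y : y \in G -> commute (coset 'Z_m(G) a) (coset 'Z_m(G) y).
  move=> Gy; apply: cent => //.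
  exact: subsetP (ucn_comm _ _) _ (mem_commg Za Gy).
have centb y : y \in 'L_k.+1(G) -> commute (coset 'Z_m(G) b) (coset 'Z_m(G) y).
  move=> Ly; have Gy: y \in G := subsetP (lcn_sub _ _) y Ly.
  apply/commute_sym/cent => //.
  exact: subsetP (comm_lcn_ucn _ _ _) _ (mem_commg Ly Zb).
have Lcx: [~ c, x] \in 'L_k.+1(G).
  by apply: subsetP (lcn_subS _ _) _ _; rewrite lcnSn mem_commg.
have ax1: [~ coset 'Z_m(G) a, coset 'Z_m(G) x * coset 'Z_m(G) b] = 1.
  by apply/eqP/commgP/commuteM; apply: centa.
have cb1: [~ coset 'Z_m(G) c, coset 'Z_m(G) b] = 1.
  by apply/eqP/commgP/commute_sym/centb.
rewrite def_c' def_x' !morphR ?nZ ?groupM //= !morphM ?nZ //=.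
rewrite commMgJ ax1 mulg1 commgMJ cb1 mul1g -!morphR ?nZ //=.
have -> : coset 'Z_m(G) [~ c, x] ^ coset 'Z_m(G) b = coset 'Z_m(G) [~ c, x].
  by apply/conjg_fixP/commgP/commute_sym/centb.
apply/esym/conjg_fixP/commgP/commute_sym/centa.
by rewrite groupR.
Qed.

(** The case m = 0 says that a commutator of weight
    k.+1 is determined by its entries modulo 'Z_k(G).  The general m is what
    the induction on the weight needs. *)
Lemma lncomm_coset_ucn G k m (s t : seq gT) :
    size s = k.+1 -> all [in G] s -> all [in G] t ->
    map (coset 'Z_(m + k)(G)) s = map (coset 'Z_(m + k)(G)) t ->
  coset 'Z_m(G) (lncomm s) = coset 'Z_m(G) (lncomm t).
Proof.
elim: k m s t => [|k IHk] m s t.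
  by case: s t => [|x [|? ?]] [|y [|? ?]] //= _ _ _; rewrite addn0; case.
case/lastP: s => // s x; case/lastP: t => [|t y].
  by rewrite map_rcons => _ _ _ /(congr1 size); rewrite size_rcons.
rewrite size_rcons !all_rcons => -[sz_s] /andP[Gx Gs] /andP[Gy Gt].
rewrite !map_rcons => /rcons_inj[eq_st eq_xy].
have sz_t: size t = k.+1.
  by rewrite -sz_s -(size_map (coset 'Z_(m + k.+1)(G)) s) eq_st size_map.
rewrite !lncomm_rcons -?size_eq0 ?sz_s ?sz_t //.
apply: (@comm_coset_ucn G k) => //; first exact: lncomm_in_lcn.
  by apply: subsetP (lcn_sub _ _) _ (lncomm_in_lcn sz_t Gt).
by apply: IHk => //; rewrite addSnnS.
Qed.

End LowerAgainstUpper.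

(** * Densities of periodic sets in products of subgroups *)

(** A right [Z]-invariant set has equal densities in [H] and [H * Z].  Count
    the pairs (h, g) in H x G with h g in A.  For fixed h, left translation by
    h permutes G.  For fixed g = h0 z, the factor z may be dropped by
    invariance, and right translation by h0 permutes H. *)
Lemma card_mulg_periodic (gT : finGroupType) (G H Z : {group gT}) (A : {set gT}) :
    G :=: H * Z ->
    {in G & Z, forall x z, (x * z \in A) = (x \in A)} ->
  (#|H| * #|G :&: A| = #|G| * #|H :&: A|)%N.
Proof.
move=> defG A_Z.
have sHG: H \subset G by rewrite defG mulG_subl.
have count (K : {group gT}) : #|K :&: A| = \sum_(x in K) (x \in A).
  rewrite -sum1_card [RHS]big_mkcond [LHS]big_mkcond /=.
  by apply: eq_bigr => x _; rewrite inE; case: (x \in K); case: (x \in A).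
transitivity (\sum_(h in H) \sum_(g in G) ((h * g)%g \in A)).
  rewrite -sum_nat_const; apply: eq_bigr => h Hh.
  have Gh: h \in G := subsetP sHG h Hh.
  rewrite count (reindex_inj (mulgI h)) /=.
  by apply: eq_bigl => g; rewrite groupMl.
rewrite exchange_big -sum_nat_const; apply: eq_bigr => g.
rewrite {1}defG => /mulsgP[h0 z Hh0 Zz ->].
rewrite count [RHS](reindex_inj (mulIg h0)) /=.
apply: eq_big => h; first by rewrite groupMr.
move=> Hh; rewrite mulgA A_Z //.
by rewrite (subsetP sHG) ?groupM.
Qed.

Section Boxes.

Variables (gT : finGroupType) (m : nat).
Implicit Types (K : 'I_m -> {set gT}) (P : pred (seq gT)).

Definition tuple_box K P : {set m.-tuple gT} :=
  [set t : m.-tuple gT | [forall i, tnth t i \in K i] && P t].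

(** Tuples carry no group structure; finite functions do, and [setXn] makes
    a product of subgroups a subgroup of them. *)
Lemma card_tuple_box K P :
  #|tuple_box K P|
    = #|setXn K :&: [set x : {dffun forall i : 'I_m, gT} | P (codom x)]|.
Proof.
pose f (t : m.-tuple gT) : {dffun forall i : 'I_m, gT} := [ffun i => tnth t i].
have inj_f: injective f.
  move=> t u /ffunP eq_tu; apply: eq_from_tnth => i.
  by have := eq_tu i; rewrite !ffunE.
have bij_f: bijective f.
  by apply: inj_card_bij => //; rewrite card_tuple card_ffun card_ord.
rewrite -(on_card_preimset (onW_bij _ bij_f)); apply: eq_card => t.
rewrite !inE; congr (_ && P _).
  by apply: eq_forallb => i; rewrite ffunE.
by rewrite codomE -[LHS]map_tnth_enum; apply: eq_map => i; rewrite ffunE.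
Qed.

Definition box_density K P : rat :=
  (#|tuple_box K P|%:R / (\prod_i #|K i|)%:R)%R.

(** In the product group, G^m is the product of the subgroups prod K_i and Z^m,
    so [card_mulg_periodic] applies to it. *)
Lemma box_density_mulg (G Z : {group gT}) (K : 'I_m -> {group gT}) P :
    G \subset 'N(Z) -> (forall i, G :=: K i * Z) ->
    (forall s t, size s = m -> all [in G] s -> all [in G] t ->
       map (coset Z) s = map (coset Z) t -> P s = P t) ->
  box_density K P = box_density (fun=> G) P.
Proof.
move=> nZG defG P_Z.
have sKG i : K i \subset G by rewrite (defG i) mulG_subl.
have sZG (i : 'I_m) : Z \subset G by rewrite (defG i) mulG_subr.
have defGm : setXn (fun=> G) = setXn K * setXn (fun i : 'I_m => (fun=> Z) i).
  apply/eqP; rewrite eqEsubset mul_subG ?setXnS // andbT.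
  apply/subsetP=> x /setXnP Gx.
  have /fin_all_exists2[k Kk Zkx] i : exists2 k, k \in K i & k^-1 * x i \in Z.
    have := Gx i; rewrite {1}(defG i) => /mulsgP[k z Kk Zz ->].
    by exists k; rewrite ?mulKg.
  apply/mulsgP; exists [ffun i => k i] [ffun i => (k i)^-1 * x i].
  - by apply/setXnP=> i; rewrite ffunE.
  - by apply/setXnP=> i; rewrite ffunE.
  - by apply/ffunP=> i; rewrite !ffunE mulKVg.
pose A := [set x : {dffun forall i : 'I_m, gT} | P (codom x)].
have A_Z: {in setXn (fun=> G) & setXn (fun=> Z),
           forall x z, (x * z \in A) = (x \in A)}.
  move=> x z /setXnP Gx /setXnP Zz; rewrite !inE; apply: P_Z.
  - by rewrite size_codom card_ord.
  - by apply/allP=> _ /codomP[i ->]; rewrite ffunE groupM // (subsetP (sZG i)).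
  - by apply/allP=> _ /codomP[i ->].
  rewrite !codomE -!map_comp; apply: eq_map => i /=; rewrite ffunE.
  have Nx: x i \in 'N(Z) by rewrite (subsetP nZG).
  have Nz: z i \in 'N(Z) by rewrite (subsetP nZG) ?(subsetP (sZG i)).
  rewrite morphM //= -[RHS]mulg1; congr (_ * _).
  exact: coset_id.
have /= := card_mulg_periodic defGm A_Z.
rewrite -!card_tuple_box !cardsXn => eq_card.
apply/eqP; rewrite /box_density.
rewrite GRing.eqr_div ?Num.Theory.pnatr_eq0 -?lt0n ?prodn_gt0 //.
by rewrite -!GRing.natrM mulnC -eq_card mulnC.
Qed.

End Boxes.

(** * Nilpotency degrees as densities *)

Section DegreesAsDensities.

Variables (gT : finGroupType) (n : nat).
Implicit Types G H : {group gT}.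

Lemma nildeg_box G :
  nildeg n G = box_density (fun _ : 'I_n.+1 => G) (fun s => lncomm s == 1).
Proof.
rewrite /nildeg /box_density prod_nat_const card_ord; congr (_%:R / _)%R.
apply: eq_card => t; rewrite !inE; congr (_ && _).
by apply/all_tnthP/forallP.
Qed.

Definition last_factor H G (i : 'I_n.+1) : {group gT} :=
  if i < n then H else G.

Lemma rel_nildeg_box H G :
  rel_nildeg n H G = box_density (last_factor H G) (fun s => lncomm s == 1).
Proof.
pose f (xg : n.-tuple gT * gT) := [tuple of rcons xg.1 xg.2].
have inj_f: injective f.
  move=> [x g] [y h] /(congr1 val)/rcons_inj[eq_xy ->].
  by congr (_, _); apply: val_inj.
have bij_f: bijective f.
  by apply: inj_card_bij => //; rewrite card_prod !card_tuple expnSr.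
rewrite /rel_nildeg /box_density; congr (_%:R / _%:R)%R; last first.
  rewrite big_ord_recr /= /last_factor ltnn; congr (_ * _)%N.
  rewrite (eq_bigr (fun=> #|H|)) ?prod_nat_const ?card_ord // => i _.
  by rewrite /= ltn_ord.
rewrite -[RHS](on_card_preimset (onW_bij _ bij_f)); apply: eq_card => -[x g].
rewrite !inE /= andbA; congr (_ && _).
apply/andP/forallP => [[/all_tnthP Hx Gg] i | Kxg].
  rewrite (tnth_nth g) /= nth_rcons size_tuple /last_factor.
  case: ltnP => [lt_in | _]; last by case: eqP.
  by have := Hx (Ordinal lt_in); rewrite (tnth_nth g).
split; last first.
  have := Kxg ord_max; rewrite (tnth_nth g) /= nth_rcons size_tuple.
  by rewrite /last_factor ltnn eqxx.
apply/all_tnthP => i; have := Kxg (widen_ord (leqnSn n) i).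
by rewrite !(tnth_nth g) /= nth_rcons size_tuple /last_factor /= ltn_ord.
Qed.

Lemma box_density_lncomm G (K : 'I_n.+1 -> {group gT}) :
    (forall i, G :=: K i * 'Z_n(G)) ->
  box_density K (fun s => lncomm s == 1) = nildeg n G.
Proof.
move=> defG; rewrite nildeg_box.
apply: (box_density_mulg (ucn_norm n G) defG) => s t sz_s Gs Gt eq_st.
have eq_c := lncomm_coset_ucn (m := 0) sz_s Gs Gt eq_st.
by congr (_ == 1); apply: (injmP (coset1_injm gT)) eq_c;
  exact: subsetP (norms1 setT) _ (in_setT _).
Qed.

End DegreesAsDensities.

(** * Automorphisms and the theorem *)

Lemma lncomm_morph (aT rT : finGroupType) (G : {group aT})
    (f : {morphism G >-> rT}) (s : seq aT) :
  all [in G] s -> lncomm (map f s) = f (lncomm s).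
Proof.
elim/last_ind: s => [|s x IHs]; first by rewrite /= morph1.
rewrite all_rcons map_rcons => /andP[Gx Gs].
have [-> // | nil_s] := eqVneq s [::].
rewrite !lncomm_rcons // -?size_eq0 ?size_map ?size_eq0 // IHs // morphR //.
case: s nil_s Gs {IHs} => // y s _ Gs.
exact: subsetP (lcn_sub _ G) _ (lncomm_in_lcn (erefl (size (y :: s))) Gs).
Qed.

Lemma rel_nildeg_Aut (gT : finGroupType) n (G H : {group gT}) (phi : {perm gT}) :
    H \subset G -> phi \in Aut G ->
  rel_nildeg n H G = rel_nildeg n (phi @: H) G.
Proof.
move=> sHG AutGphi.
pose f (xg : n.-tuple gT * gT) := ([tuple of map phi xg.1], phi xg.2).
have inj_f: injective f.
  move=> [x g] [y h] [/(inj_map perm_inj) eq_xy /perm_inj->].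
  by congr (_, _); apply: val_inj.
rewrite /rel_nildeg card_imset; last exact: perm_inj.
congr (_%:R / _)%R.
rewrite -[RHS](on_card_preimset (onW_bij _ (injF_bij inj_f))).
apply: eq_card => -[x g]; rewrite !inE /=.
have -> : all [in phi @: H] [seq phi y | y <- x] = all [in H] x.
  rewrite all_map; apply: eq_all => y /=.
  by rewrite mem_imset //; exact: perm_inj.
have /setIdP[onGphi _] := AutGphi; rewrite (perm_closed _ onGphi).
apply: andb_id2l => Hx; apply: andb_id2l => Gg.
have Gxg: all [in G] (rcons x g).
  by rewrite all_rcons Gg; apply: sub_all Hx => y /(subsetP sHG).
rewrite -map_rcons -(autmE AutGphi) lncomm_morph //= autmE.
have phi1: phi 1 = 1 by rewrite -(autmE AutGphi) morph1.
by rewrite -[in RHS]phi1 (inj_eq perm_inj).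
Qed.

Theorem theoremD (gT : finGroupType) (G H : {group gT}) (n : nat)
    (n_gt0 : 0 < n) (sHG : H \subset G) :
  (G :=: (H * 'Z_n(G))%g ->
     nildeg n H = rel_nildeg n H G /\ rel_nildeg n H G = nildeg n G)
  /\ (forall phi : {perm gT}, phi \in Aut G ->
        rel_nildeg n H G = rel_nildeg n (phi @: H) G).
Proof.
split=> [defG | phi]; last exact: rel_nildeg_Aut.
have dH := box_density_lncomm (fun _ : 'I_n.+1 => defG).
have dHG: rel_nildeg n H G = nildeg n G.
  rewrite rel_nildeg_box (box_density_lncomm (G := G)) // => i; rewrite /last_factor.
  by case: ifP => _ //; rewrite mulGSid ?ucn_sub.
by rewrite dHG nildeg_box.
Qed.
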